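(* For $i=1,2$, let $G_i$ be a graph of order $n_i$ with no isolated vertices, and let $m$ be a positive integer with $2^{\frac{106\sqrt{m}}{\log m}}\ge n-27\sqrt{m}$, where $n=\max\{n_1,n_2\}$. Suppose also that for each $\alpha$ with $27\le \alpha\le \frac{\log^{3} m}{8}$ both of the following properties hold. (I) For $i=1,2$ there exists $U_i\subseteq V(G_i)$ such that $|U_i|\le \alpha\sqrt{m}$ and $\Delta(G_i-U_i)\le \frac{2\sqrt{m}}{\alpha}$. (II) For $i=1,2$ there exists $V_i\subseteq V(G_i)$ such that $|V_i|\le m^{\frac{3}{2}}$ and $\max\{R(G_1-V_1,G_2),\,R(G_1,G_2-V_2)\}\le 2^{36\sqrt{m}}$. Then $R(G_1,G_2)\le 2^{250\sqrt{m}}$.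
   Context: Graphs are finite and simple. For graphs $G_1,G_2$, the Ramsey number $R(G_1,G_2)$ is the smallest positive integer $N$ such that every blue-red edge coloring of the complete graph $K_N$ contains a blue subgraph isomorphic to $G_1$ or a red subgraph isomorphic to $G_2$. $\log$ denotes the logarithm in base $2$, and $\log^3 m=(\log m)^3$. The order of a graph is its number of vertices, $V(G)$ is the vertex set of $G$, $\Delta(\cdot)$ denotes maximum degree, and $G-U$ is the graph obtained from $G$ by deleting the vertices in $U$.
   Formalization: Adds 27 ≤ (log m)^3/8, i.e. m ≥ 64: for 2 ≤ m < 64 no α is in the range, so (I) and (II) are vacuous and the claim fails (e.g. m = 2, G_1 = G_2 = K_1000); for m = 1 the exponent 106√m/log m is undefined. *)

(* Defs.v *)
From mathcomp Require Import all_boot all_order all_algebra.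
From mathcomp Require Import reals exp.

Set Implicit Arguments.
Unset Strict Implicit.
Unset Printing Implicit Defensive.

Import GRing.Theory Num.Theory.

Record sgraph := SGraph {
  vertex :> finType;
  edge : rel vertex;
  edge_sym : symmetric edge;
  edge_irrefl : irreflexive edge }.

Arguments edge {s}.

Definition no_isolated (G : sgraph) : bool := [forall x : G, exists y : G, edge x y].

Definition degree (G : sgraph) (x : G) : nat := #|[set y : G | edge x y]|.

Definition max_degree (G : sgraph) : nat := \max_(x : G) degree x.

Section Delete.
Variables (G : sgraph) (U : {set G}).

Definition delete_edge : rel {x : G | x \notin U} :=
  fun x y => edge (val x) (val y).

Lemma delete_edge_sym : symmetric delete_edge.
Proof. by move=> x y; exact: edge_sym. Qed.

Lemma delete_edge_irrefl : irreflexive delete_edge.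
Proof. by move=> x; exact: edge_irrefl. Qed.

(* G - U; it is the graph without vertices when U is everything. *)
Definition delete : sgraph := SGraph delete_edge_sym delete_edge_irrefl.

End Delete.

(* H has a (not necessarily induced) subgraph isomorphic to G. *)
Definition contains_copy (H G : sgraph) : bool :=
  [exists f : {ffun G -> H},
    injectiveb f && [forall x, forall y, edge x y ==> edge (f x) (f y)]].

(* An edge of K_N is a two-element set of vertices, so a blue-red colouring is
   a map c on sets, true being blue and false red; the values of c on sets that
   are not of size two are irrelevant. *)
Section ColourGraph.
Variables (N : nat) (c : {ffun {set 'I_N} -> bool}) (b : bool).

Definition colour_edge : rel 'I_N :=
  fun x y => (x != y) && (c [set x; y] == b).

Lemma colour_edge_sym : symmetric colour_edge.
Proof. by move=> x y; rewrite /colour_edge eq_sym setUC. Qed.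

Lemma colour_edge_irrefl : irreflexive colour_edge.
Proof. by move=> x; rewrite /colour_edge eqxx. Qed.

Definition colour_graph : sgraph := SGraph colour_edge_sym colour_edge_irrefl.

End ColourGraph.

Definition arrows (G1 G2 : sgraph) (N : nat) : bool :=
  [forall c : {ffun {set 'I_N} -> bool},
    contains_copy (colour_graph c true) G1
    || contains_copy (colour_graph c false) G2].

Section RamseyExists.

Lemma ramsey_cliques (T : finType)
    (e1 e2 : rel T) (e1s : symmetric e1) (e2s : symmetric e2)
    (e12 : forall x y, x != y -> e1 x y || e2 x y) (k a b : nat) (A : {set T}) :
  a + b <= k -> 2 ^ k <= #|A| ->
  (exists2 S : {set T}, #|S| = a & {in S &, forall x y, x != y -> e1 x y}) \/
  (exists2 S : {set T}, #|S| = b & {in S &, forall x y, x != y -> e2 x y}).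
Proof.
suff main : forall k a b (A : {set T}), a + b <= k -> 2 ^ k <= #|A| ->
  (exists2 S : {set T}, S \subset A /\ #|S| = a &
     {in S &, forall x y, x != y -> e1 x y}) \/
  (exists2 S : {set T}, S \subset A /\ #|S| = b &
     {in S &, forall x y, x != y -> e2 x y}).
  move=> ab kA; case: (main k a b A ab kA) => -[S [_ cS] cl];
  by [left; exists S | right; exists S].
have ext (e : rel T) (es : symmetric e) (x : T) (S : {set T}) n :
    #|S| = n -> x \notin S -> {in S, forall y, e x y} ->
    {in S &, forall y z, y != z -> e y z} ->
    #|x |: S| = n.+1 /\ {in x |: S &, forall y z, y != z -> e y z}.
  move=> cS xS ex cl; split; first by rewrite cardsU1 xS cS.
  move=> y z /setU1P[->|yS] /setU1P[->|zS] yz; first by rewrite eqxx in yz.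
  - exact: ex.
  - by rewrite es; exact: ex.
  - exact: cl.
move=> {}k; elim: k => [|k IH] {}a {}b {}A.
  rewrite leqn0 addn_eq0 => /andP[/eqP -> _] _.
  by left; exists set0; [rewrite sub0set cards0 | move=> x y; rewrite inE].
case: a => [|a]; first by move=> _ _; left; exists set0;
  [rewrite sub0set cards0 | move=> x y; rewrite inE].
case: b => [|b]; first by move=> _ _; right; exists set0;
  [rewrite sub0set cards0 | move=> x y; rewrite inE].
move=> ab kA.
have /card_gt0P[x xA] : 0 < #|A| by apply: leq_trans kA; rewrite expn_gt0.
pose B := [set y in A :\ x | e1 x y]; pose C := [set y in A :\ x | ~~ e1 x y].
have BC : #|B| + #|C| = #|A|.-1.
  rewrite (cardsD1 x A) xA /= -cardsUI.
  have -> : B :&: C = set0.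
    by apply/setP=> y; rewrite !inE; case: (e1 x y); rewrite ?andbF.
  rewrite cards0 addn0; apply: eq_card => y; rewrite !inE.
  by case: (e1 x y); rewrite ?andbT ?andbF ?orbF.
have sub (D S : {set T}) : D \subset A :\ x -> S \subset D ->
    x |: S \subset A /\ x \notin S.
  move=> DA SD; have SA := subset_trans SD DA; split.
    by rewrite subUset sub1set xA (subset_trans SA) // subsetDl.
  by apply/negP=> /(subsetP SA); rewrite !inE eqxx.
have BA : B \subset A :\ x by apply/subsetP=> y; rewrite inE => /andP[].
have CA : C \subset A :\ x by apply/subsetP=> y; rewrite inE => /andP[].
have [kB|kB] := leqP (2 ^ k) #|B|.
  case: (IH a b.+1 B _ kB); first by rewrite -ltnS -addSn.
    case=> S [SB cS] cl; left; have [sA xS] := sub _ _ BA SB.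
    have [|cS' cl'] := ext e1 e1s x S a cS xS _ cl.
      by move=> y /(subsetP SB); rewrite inE => /andP[].
    by exists (x |: S).
  case=> S [SB cS] cl; right; exists S => //; split=> //.
  by rewrite (subset_trans SB) // (subset_trans BA) // subsetDl.
have kC : 2 ^ k <= #|C|.
  rewrite -(leq_add2l #|B|) BC -ltnS prednK; last first.
    by apply: leq_trans kA; rewrite expn_gt0.
  apply: leq_trans kA; rewrite expnS mul2n -addnn -addSn.
  by rewrite leq_add2r.
case: (IH a.+1 b C _ kC); first by rewrite -ltnS -addnS.
  case=> S [SC cS] cl; left; exists S => //; split=> //.
  by rewrite (subset_trans SC) // (subset_trans CA) // subsetDl.
case=> S [SC cS] cl; right; have [sA xS] := sub _ _ CA SC.
have [|cS' cl'] := ext e2 e2s x S b cS xS _ cl; last by exists (x |: S).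
move=> y /(subsetP SC); rewrite !inE => /andP[/andP[yx _] ne].
by have := e12 x y; rewrite eq_sym (negPf ne) => /(_ yx).
Qed.

Lemma clique_contains_copy (H G : sgraph) (S : {set H}) :
  #|S| = #|G| -> {in S &, forall x y, x != y -> edge x y} -> contains_copy H G.
Proof.
move=> cS cl.
pose f := [ffun x : G => enum_val (cast_ord (esym cS) (enum_rank x))].
have finj : injective f.
  by move=> x y; rewrite !ffunE => /enum_val_inj/cast_ord_inj/enum_rank_inj.
have fS x : f x \in S by rewrite ffunE; exact: enum_valP.
apply/existsP; exists f; apply/andP; split; first exact/injectiveP.
apply/forallP=> x; apply/forallP=> y; apply/implyP=> xy.
apply: cl; rewrite ?fS // (inj_eq finj); apply/eqP=> xyE.
by move: xy; rewrite xyE edge_irrefl.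
Qed.

Lemma ramsey_exists (G1 G2 : sgraph) :
  exists N, (0 < N) && arrows G1 G2 N.
Proof.
exists (2 ^ (#|G1| + #|G2|)); rewrite expn_gt0 /=; apply/forallP=> c.
apply/orP.
have e12 (x y : 'I_(2 ^ (#|G1| + #|G2|))) :
    x != y -> colour_edge c true x y || colour_edge c false x y.
  by rewrite /colour_edge => ->; case: (c _).
have [||[S cS cl]|[S cS cl]] := @ramsey_cliques _ _ _
  (@colour_edge_sym _ c true) (@colour_edge_sym _ c false) e12
  (#|G1| + #|G2|) #|G1| #|G2| setT.
- by [].
- by rewrite cardsT card_ord.
- by left; apply: (@clique_contains_copy (colour_graph c true) G1 S).
- by right; apply: (@clique_contains_copy (colour_graph c false) G2 S).
Qed.

End RamseyExists.

(* R(G1, G2). *)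
Definition ramsey (G1 G2 : sgraph) : nat := ex_minn (ramsey_exists G1 G2).

Definition log2 (R : realType) (x : R) : R := (ln x / ln 2)%R.

(* Main.v *)
Require Import Defs.
From mathcomp Require Import all_boot all_order all_algebra.
From mathcomp Require Import boolp reals exp.
From mathcomp Require Import zify lra.

(** The argument builds, inside a colouring of [K_N] with [N = 2 ^ (222 * M)]
    and [M] just above [sqrt m], larger and larger monochromatic books: a spine
    [A] that is a clique in one colour, joined completely in that colour to a set
    of pages [B].  A book is useful because of (I): the high degree vertices
    [U] of [G] can be put on the spine, so a copy of [G - U] in the pages is
    enough for a copy of [G] ([book_embeds]).

    Suppose no copy of [G_1] or [G_2] of its own colour appears, and take a book
    with a spine of [y ^ 3 * M] vertices.  Its pages contain no copy, in the
    colour of the book, of a graph of maximum degree at most [2 * M / y ^ 3].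
    Greedy vertex-by-vertex embedding can only fail if there are two large sets
    with few edges of that colour between them ([embeds_or_sparse_pair]);
    iterating inside both sets gives a large set of pages in which the colour has
    density at most [2 ^ (- 5 * y)] ([sparse_subset]).  A colouring in which
    one colour is that sparse has, by the Erdos-Szemeredi argument, a
    book whose spine is much longer than the Ramsey bound gives
    ([sparse_book]).  Together these turn a spine of [y ^ 3 * M]
    vertices into one of [4 ^ y.+1 * M], in either colour, while the number of
    pages drops by a factor of at most [2 ^ (198 * M / y)] ([book_step]).

    Since [4 ^ y.+1] exceeds [(2 * y) ^ 3], the parameter [y] can be doubled each
    time, starting from [y = 3], and the exponents lost form a geometric series of
    sum at most [2 * 198 * M / 3 = 132 * M].  The first book, with [27 * M]
    vertices on the spine, costs [54 * M] by the Erdos-Szekeres recursion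
    ([book_ramsey]).  Once [4 ^ y > m / 4] the spine has
    more than [m ^ (3 / 2)] vertices and can hold the set [V_i] of (II), so
    [2 ^ (36 * M)] pages suffice to finish.  The total is
    [54 + 132 + 36 = 222], and [222 * M <= 250 * sqrt m] because [m >= 64] makes
    [8 * M <= 9 * sqrt m]. *)

Set Implicit Arguments.
Unset Strict Implicit.
Unset Printing Implicit Defensive.

Import Order.TTheory GRing.Theory Num.Theory.

(** * Binomial coefficients *)

(** The classical [(1 + 1/n) ^ n <= 4] for [n = 2 ^ j]: the sequence
    [(n / (n - 1)) ^ n] dominates it and decreases along doublings of [n],
    starting from the value 4 at [n = 2]. *)
Lemma expn_succ_le4 j : 0 < j -> (2 ^ j).+1 ^ (2 ^ j) <= 4 * (2 ^ j) ^ (2 ^ j).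
Proof.
case: j => // j _.
have pred_le4 : (2 ^ j.+1) ^ (2 ^ j.+1) <= 4 * (2 ^ j.+1).-1 ^ (2 ^ j.+1).
  elim: j => [|j IH] //.
  set n := 2 ^ j.+1 in IH *.
  have n2 : 1 < n by rewrite /n -[1]/(2 ^ 0) ltn_exp2l.
  have -> : 2 ^ j.+2 = 2 * n by rewrite expnS.
  have h : n * n.-1 * 4 <= (2 * n).-1 ^ 2 by nia.
  have h2 : (n * n.-1 * 4) ^ n <= ((2 * n).-1 ^ 2) ^ n by rewrite leq_exp2r //; lia.
  rewrite !expnM; apply: (leq_trans _ (leq_mul (leqnn 4) h2)).
  have -> : (2 * n) ^ 2 = n * n * 4 by rewrite -mulnn; lia.
  rewrite !expnMn; nia.
set n := 2 ^ j.+1 in pred_le4 *.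
have n2 : 1 < n by rewrite /n -[1]/(2 ^ 0) ltn_exp2l.
have h : (n.+1 * n.-1) ^ n <= (n * n) ^ n by rewrite leq_exp2r //; nia.
rewrite !expnMn in h.
have p0 : 0 < n.-1 ^ n by rewrite expn_gt0; apply/orP; left; lia.
rewrite -(leq_pmul2r p0); nia.
Qed.

(** Keeping one term of the expansion of [(1 + x) ^ p], with [x = 2 ^ (- j)],
    bounds ['C(p, z)] by [x ^ (- z) * (1 + x) ^ p].  The exponent is far below [p]
    when both [z] and [p * x] are, which is how sparsity pays off. *)
Lemma bin_le_expn j p z : 0 < j -> 'C(p, z) <= 2 ^ (j * z + 2 * (p %/ 2 ^ j).+1).
Proof.
move=> j0; set n := 2 ^ j; set q := (p %/ n).+1.
have n0 : 0 < n by rewrite expn_gt0.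
have pq : p <= n * q by rewrite mulnC ltnW // ltn_ceil.
apply: (leq_trans (leq_bin2l z pq)).
have [zq|zq] := leqP z (n * q); last by rewrite bin_small.
have low : 'C(n * q, z) * n ^ (n * q - z) <= n.+1 ^ (n * q).
  rewrite -(addn1 n) expnDn (bigD1 (inord z)) //= inordK ?ltnS //.
  by rewrite exp1n muln1 leq_addr.
have up : n.+1 ^ (n * q) <= 4 ^ q * n ^ (n * q).
  by rewrite expnM [n ^ _]expnM -expnMn leq_exp2r // expn_succ_le4.
have p0 : 0 < n ^ (n * q - z) by rewrite expn_gt0 n0.
rewrite -(leq_pmul2r p0); apply: (leq_trans low); apply: (leq_trans up).
rewrite -{1}(subnK zq) [n ^ (_ + _)]expnD expnD !expnM -/n.
by rewrite -[2 ^ 2]/4; lia.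
Qed.

(** * Degrees and edge counts *)

Definition deg_in (T : finType) (e : rel T) (B : {set T}) (x : T) : nat :=
  #|[set y in B | e x y]|.

Lemma deg_in_sum (T : finType) (e : rel T) (B : {set T}) (x : T) :
  deg_in e B x = \sum_(y in B) e x y.
Proof.
rewrite /deg_in -sum1_card (eq_bigl (fun y => (y \in B) && e x y)); last first.
  by move=> y; rewrite inE.
by rewrite -big_mkcondr /=; apply: eq_bigr => y _; case: (e x y).
Qed.

Lemma deg_in_double_count (T : finType) (e : rel T) (es : symmetric e) (A B : {set T}) :
  \sum_(x in A) deg_in e B x = \sum_(y in B) deg_in e A y.
Proof.
rewrite (eq_bigr _ (fun x _ => deg_in_sum e B x)) exchange_big /=.
by apply: eq_bigr => y _; rewrite deg_in_sum; apply: eq_bigr => x _; rewrite es.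
Qed.

(** Markov's inequality in counting form. *)
Lemma card_above_le (T : finType) (B : {set T}) (g : T -> nat) r q :
  \sum_(x in B) g x <= q -> r * #|[set x in B | r < g x]| <= q.
Proof.
move=> /(leq_trans _); apply; rewrite mulnC -sum_nat_const big_mkcond [leqRHS]big_mkcond.
by apply: leq_sum => x _; rewrite inE; case: (x \in B) => //=; case: ltnP => // /ltnW.
Qed.

(** * Monochromatic books *)

Definition clique (T : finType) (e : rel T) (A : {set T}) : Prop :=
  {in A &, forall x y, x != y -> e x y}.

Definition book (T : finType) (e : rel T) (A B : {set T}) : Prop :=
  clique e A /\ {in A & B, forall x y, e x y}.

Lemma clique_setU (T : finType) (e : rel T) (es : symmetric e) (A B : {set T}) :
  clique e A -> clique e B -> {in A & B, forall x y, e x y} -> clique e (A :|: B).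
Proof.
move=> cA cB AB x y /setUP[xA|xB] /setUP[yA|yB] xy; [exact: cA|exact: AB| |exact: cB].
by rewrite es; apply: AB.
Qed.

Lemma clique_sub (T : finType) (e : rel T) (A B : {set T}) :
  A \subset B -> clique e B -> clique e A.
Proof. by move=> AB cB x y /(subsetP AB) xB /(subsetP AB) yB; apply: cB. Qed.

Lemma clique1 (T : finType) (e : rel T) (x : T) : clique e [set x].
Proof. by move=> a b /set1P-> /set1P->; rewrite eqxx. Qed.

Lemma clique0 (T : finType) (e : rel T) : clique e set0.
Proof. by move=> a b; rewrite inE. Qed.

Lemma book_add (T : finType) (e : rel T) (es : symmetric e) (x : T) (B A C : {set T}) a :
  x \in B -> A \subset [set y in B :\ x | e x y] -> C \subset [set y in B :\ x | e x y] ->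
  #|A| = a -> book e A C ->
  [/\ x |: A \subset B, C \subset B, #|x |: A| = a.+1 & book e (x |: A) C].
Proof.
move=> xB /subsetP AN /subsetP CN <- [cA AC].
have xA : x \notin A by apply/negP => /AN; rewrite !inE eqxx.
split.
- by apply/subsetP => y /setU1P[->//|/AN]; rewrite !inE -andbA => /and3P[].
- by apply/subsetP => y /CN; rewrite !inE -andbA => /and3P[].
- by rewrite cardsU1 xA.
split=> [|u v /setU1P[->|uA] vC]; last exact: AC.
  apply: clique_setU => //; first exact: clique1.
  by move=> u v /set1P-> /AN; rewrite inE => /andP[].
by have := CN _ vC; rewrite inE => /andP[].
Qed.

(** The Erdos-Szekeres induction, started from books with an empty spine and [L]
    pages instead of empty cliques; Pascal's rule for ['C(a + b, a)] matches the
    choice of the next neighbourhood. *)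
Lemma book_ramsey (T : finType) (e f : rel T) (es : symmetric e) (fs : symmetric f)
    (ef : forall x y, x != y -> e x y || f x y) L a b (B : {set T}) :
  0 < L -> L * 'C(a + b, a) <= #|B| ->
  (exists A C : {set T}, [/\ A \subset B, C \subset B, #|A| = a, L <= #|C| & book e A C]) \/
  (exists A C : {set T}, [/\ A \subset B, C \subset B, #|A| = b, L <= #|C| & book f A C]).
Proof.
move=> L0.
have triv (g : rel T) (D : {set T}) : L <= #|D| ->
    exists A C : {set T}, [/\ A \subset D, C \subset D, #|A| = 0, L <= #|C| & book g A C].
  move=> LD; exists set0, D; split=> //; rewrite ?sub0set ?cards0 //.
  by split; [exact: clique0 | move=> x y; rewrite inE].
move: {2}(a + b) (leqnn (a + b)) => k.
elim: k a b B => [|k IH] [|a] [|b] B //.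
- by move=> _; rewrite bin0 muln1 => /triv; left.
- by move=> _; rewrite bin0 muln1 => /triv; left.
- by move=> _; rewrite bin0 muln1 => /triv; left.
- by move=> _; rewrite addn0 binn muln1 => /triv; right.
move=> abk LB.
have [x xB] : exists x, x \in B.
  by apply/card_gt0P; apply: leq_trans LB; rewrite muln_gt0 L0 bin_gt0 leq_addr.
set Ne := [set y in B :\ x | e x y]; set Nf := [set y in B :\ x | f x y].
have cov : #|B| <= (#|Ne| + #|Nf|).+1.
  rewrite (cardsD1 x) xB add1n ltnS -cardsUI; apply: (leq_trans _ (leq_addr _ _)).
  apply: subset_leq_card; apply/subsetP => y; rewrite !inE => /andP[yx yB].
  by rewrite yx yB /= ef // eq_sym.
move: LB; rewrite addSn binS -addSnnS mulnDr => LB.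
have [He|He] := leqP (L * 'C(a + b.+1, a)) #|Ne|.
  case: (IH a b.+1 Ne _ He); first by rewrite -ltnS -addSn.
    move=> [A [C [AN CN cA LC bk]]]; left; exists (x |: A), C.
    by have [] := book_add es xB AN CN cA bk; split.
  move=> [A [C [AN CN cA LC bk]]]; right; exists A, C.
  have NB : Ne \subset B by apply/subsetP => y; rewrite !inE -andbA => /and3P[].
  by split=> //; apply: subset_trans NB.
have Hf : L * 'C(a.+1 + b, a.+1) <= #|Nf| by rewrite -addSnnS in He; lia.
case: (IH a.+1 b Nf _ Hf); first by rewrite -ltnS -addnS.
  move=> [A [C [AN CN cA LC bk]]]; left; exists A, C.
  have NB : Nf \subset B by apply/subsetP => y; rewrite !inE -andbA => /and3P[].
  by split=> //; apply: subset_trans NB.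
move=> [A [C [AN CN cA LC bk]]]; right; exists (x |: A), C.
by have [] := book_add fs xB AN CN cA bk; split.
Qed.

(** A weighted pigeonhole principle on the traces of the vertices of [B] on [X]:
    processing [X] one vertex at a time, the branch taken is the one allowed by
    Pascal's rule, and at most [z] times is it the branch of the neighbours. *)
Lemma common_trace (T : finType) (e : rel T) (L z : nat) (X B : {set T}) :
  {in B, forall v, deg_in e X v <= z} -> L * 'C(#|X| + z, z) <= #|B| ->
  exists Y C : {set T}, [/\ Y \subset X, C \subset B, #|Y| <= z, L <= #|C| &
    {in C & X :\: Y, forall v x, ~~ e v x}].
Proof.
move: {2}#|X| (erefl #|X|) => n; elim: n => [|n IH] in z X B *.
  move=> /eqP; rewrite cards_eq0 => /eqP-> _; rewrite cards0 binn muln1 => LB.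
  exists set0, B; split; rewrite ?sub0set ?cards0 //.
  by move=> v x; rewrite !inE.
move=> cX dX; rewrite cX => LB.
have [x xX] : exists x, x \in X by apply/card_gt0P; rewrite cX.
have cX' : #|X :\ x| = n by move: cX; rewrite (cardsD1 x) xX => -[].
set B1 := [set v in B | e v x]; set B0 := [set v in B | ~~ e v x].
have B10 : #|B| <= #|B1| + #|B0|.
  rewrite -cardsUI; apply: (leq_trans _ (leq_addr _ _)); apply: subset_leq_card.
  by apply/subsetP => v vB; rewrite !inE vB /=; case: (e v x).
have dE v : deg_in e X v = e v x + deg_in e (X :\ x) v.
  rewrite /deg_in (cardsD1 x) inE xX /=; congr (_ + _).
  by apply: eq_card => y; rewrite !inE andbA.
have [B1L|B1S] := posnP z.
  subst z; rewrite bin0 muln1 in LB.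
  have dx v : v \in B -> forall y, y \in X -> ~~ e v y.
    move=> vB y yX; apply/negP => evy; have := dX _ vB; rewrite leqn0 cards_eq0 => /eqP D.
    by have := in_set0 y; rewrite -D inE yX evy.
  exists set0, B; split; rewrite ?sub0set ?cards0 //.
  by move=> v y vB; rewrite setD0; apply: dx.
case: z B1S dX LB => // z _ dX LB.
rewrite addSn binS mulnDr in LB.
have [L0|L0] := leqP (L * 'C(n + z.+1, z.+1)) #|B0|.
  case: (IH z.+1 (X :\ x) B0 cX'); rewrite ?cX' //.
    by move=> v; rewrite inE => /andP[vB /negPf nv]; have := dX _ vB; rewrite dE nv.
  move=> Y [C [YX CB cY LC nC]]; exists Y, C; split=> //.
  - exact: subset_trans YX (subsetDl _ _).
  - by apply: subset_trans CB _; apply/subsetP => v; rewrite inE => /andP[].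
  move=> v y vC; rewrite inE => /andP[yY yX].
  have [->|yx] := eqVneq y x.
    by have := subsetP CB v vC; rewrite inE => /andP[].
  by apply: nC; rewrite // !inE yY yx yX.
have L1 : L * 'C(n + z, z) <= #|B1|.
  have : L * 'C(n + z, z) <= L * 'C(n + z.+1, z).
    by rewrite leq_mul2l leq_bin2l ?orbT // leq_add2l.
  lia.
case: (IH z (X :\ x) B1 cX'); rewrite ?cX' //.
  by move=> v; rewrite inE => /andP[vB ev]; have := dX _ vB; rewrite dE ev ltnS.
move=> Y [C [YX CB cY LC nC]]; exists (x |: Y), C; split=> //.
- by rewrite subUset sub1set xX (subset_trans YX) ?subsetDl.
- by apply: subset_trans CB _; apply/subsetP => v; rewrite inE => /andP[].
- by rewrite cardsU1; case: (x \notin Y) => //; lia.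
move=> v y vC; rewrite !inE negb_or -andbA => /and3P[yx yY yX].
by apply: nC; rewrite // !inE yY yx yX.
Qed.

(** * Books in sparse colourings *)

Lemma subset_of_card (T : finType) (A : {set T}) n :
  n <= #|A| -> exists2 B : {set T}, B \subset A & #|B| = n.
Proof.
move=> /card_geqP[s [us <- sA]]; exists [set:: s].
  by apply/subsetP => x; rewrite inE => /sA.
by rewrite cardsE; apply/card_uniqP.
Qed.

Lemma card_split (T : finType) (B : {set T}) (P : pred T) :
  #|[set x in B | P x]| + #|[set x in B | ~~ P x]| = #|B|.
Proof.
rewrite -[RHS](cardsID [set x | P x]); congr (_ + _).
  by apply: eq_card => x; rewrite !inE.
by apply: eq_card => x; rewrite !inE andbC.
Qed.

(** Adjacent pairs are ordered: for a graph this is twice the number of edges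
    inside [S]. *)
Definition adjacent_pairs (T : finType) (e : rel T) (S : {set T}) := \sum_(x in S) deg_in e S x.

(** Let [X] be a largest [f]-clique of at most [2 * t] vertices among the
    vertices of low [e]-degree.  Typical vertices have at most [z] [e]-neighbours in
    [X], so many of them, [C], have all of these inside one set [Y] of at most [z]
    vertices.  If [X] reached size [2 * t], then [X] minus [Y] is the spine of an
    [f]-book.  Otherwise, as [X] cannot be improved by replacing [Y] with an
    [f]-clique of [C], there is no [f]-clique of [z.+1] vertices in [C], and the very
    unbalanced Ramsey bound yields an [e]-book. *)
Lemma sparse_book (T : finType) (e f : rel T) (es : symmetric e) (fs : symmetric f)
    (ef : forall x y, x != y -> e x y || f x y) k t z L (S : {set T}) :
  0 < L -> 0 < t -> z <= t -> 16 * t < 2 ^ k * z.+1 ->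
  2 ^ k * adjacent_pairs e S <= #|S| ^ 2 ->
  4 * (2 * t + L * 'C(t + z.+1, z.+1) * 'C(2 * t + z, z)) <= #|S| ->
  (exists A C : {set T}, [/\ A \subset S, C \subset S, #|A| = t, L <= #|C| & book e A C]) \/
  (exists A C : {set T}, [/\ A \subset S, C \subset S, #|A| = t, L <= #|C| & book f A C]).
Proof.
move=> L0 t0 zt tz sparse big; set w := #|S| in sparse big *.
have w0 : 0 < w by apply: leq_trans big; lia.
set low := fun v => 2 ^ k * deg_in e S v <= 2 * w.
set W := [set v in S | low v].
have WS : W \subset S by apply/subsetP => v; rewrite inE => /andP[].
(* Markov: the average degree is w / 2^k, hence half of S has at most twice that. *)
have Wbig : w <= 2 * #|W|.
  have := card_split S low; rewrite -/W -/w.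
  have -> : [set v in S | ~~ low v] = [set v in S | 2 * w < 2 ^ k * deg_in e S v].
    by apply/setP => v; rewrite !inE ltnNge.
  have := @card_above_le T S (fun v => 2 ^ k * deg_in e S v) (2 * w) (w ^ 2).
  rewrite -big_distrr => /(_ sparse); set b := #|_|.
  rewrite -mulnn => bw; have : 2 * b <= w by nia.
  lia.
pose P (X : {set T}) := [&& X \subset W, `[< clique f X >] & #|X| <= 2 * t].
have P0 : P set0 by rewrite /P sub0set cards0 andbT; apply/asboolP/clique0.
case: (arg_maxnP (fun X : {set T} => #|X|) P0) => X /and3P[XW /asboolP cX X2t] Xmax.
set W2 := [set v in W | 2 ^ k * deg_in e X v <= 16 * t].
(* The e-edges between X and S number at most |X| * 2w / 2^k, so a quarter of S at
   most can see more than 16t / 2^k vertices of X. *)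
have W2big : w <= 4 * #|W2|.
  have := card_split W (fun v => 2 ^ k * deg_in e X v <= 16 * t); rewrite -/W2.
  have -> : [set v in W | ~~ (2 ^ k * deg_in e X v <= 16 * t)] =
            [set v in W | 16 * t < 2 ^ k * deg_in e X v].
    by apply/setP => v; rewrite !inE ltnNge.
  have := @card_above_le T W (fun v => 2 ^ k * deg_in e X v) (16 * t) (4 * t * w).
  have -> : \sum_(x in W) 2 ^ k * deg_in e X x <= 4 * t * w.
    apply: (@leq_trans (\sum_(x in S) 2 ^ k * deg_in e X x)).
      rewrite big_mkcond [leqRHS]big_mkcond; apply: leq_sum => v _.
      by case: ifP => // /(subsetP WS)->.
    rewrite -big_distrr /= (deg_in_double_count es) big_distrr /=.
    apply: (@leq_trans (\sum_(x in X) 2 * w)).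
      by apply: leq_sum => v /(subsetP XW); rewrite inE => /andP[].
    rewrite sum_nat_const; nia.
  move=> /(_ isT); set b := #|_| => bw; have : 4 * b <= w by nia.
  lia.
set L' := L * 'C(t + z.+1, z.+1).
have [||Y [C [YX CW cY LC nC]]] := @common_trace T e L' z X (W2 :\: X).
- move=> v; rewrite !inE => /and3P[_ _ vt]; rewrite -ltnS.
  by rewrite -(ltn_pmul2l (expn_gt0 2 k)) (leq_ltn_trans vt).
- have X1 : #|W2| <= #|W2 :\: X| + #|X|.
    by rewrite -(cardsID X W2) addnC leq_add2l subset_leq_card // subsetIr.
  have : L' * 'C(#|X| + z, z) <= L' * 'C(2 * t + z, z).
    by rewrite leq_mul2l leq_bin2l ?orbT // leq_add2r.
  lia.
have CXW : C \subset W2 :\: X by [].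
have CW1 : C \subset W.
  apply: subset_trans CXW _; apply/subsetP => v; rewrite !inE.
  by move=> /andP[_ /andP[]].
have fXC : {in X :\: Y & C, forall x v, f x v}.
  move=> x v xX vC; have := nC _ _ vC xX.
  have /ef : v != x.
    apply/eqP => vx; have := subsetP CXW _ vC; rewrite vx inE.
    by move: xX; rewrite inE => /andP[_ ->].
  by rewrite fs; case: (e v x).
have L'0 : 0 < L' by rewrite muln_gt0 L0 bin_gt0 leq_addl.
have cXY : #|X :\: Y| = #|X| - #|Y| by rewrite cardsD (setIidPr YX).
move: X2t; rewrite leq_eqVlt => /orP[/eqP X2t|X2t].
  right; have [A AX cA] : exists2 A : {set T}, A \subset X :\: Y & #|A| = t.
    by apply: subset_of_card; rewrite cXY; lia.
  exists A, C; split=> //.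
  - apply: subset_trans AX _; apply: subset_trans (subsetDl _ _) _.
    exact: subset_trans WS.
  - exact: subset_trans WS.
  - apply: leq_trans LC; rewrite /L' leq_pmulr // bin_gt0 leq_addl //.
  split; last by move=> x v /(subsetP AX); apply: fXC.
  by apply: clique_sub cX; apply: subset_trans AX (subsetDl _ _).
have := @book_ramsey T e f es fs ef L t z.+1 C L0.
rewrite -bin_sub ?leq_addr // addKn => /(_ LC) [] [A [D [AC DC cA LD bk]]].
  left; exists A, D; split=> //.
  - exact: subset_trans AC (subset_trans CW1 WS).
  - exact: subset_trans DC (subset_trans CW1 WS).
have fXA : {in X :\: Y & A, forall x v, f x v}.
  by move=> x v xX /(subsetP AC); apply: fXC.
(* Replacing Y by A in X gives a longer clique, of which X.+1 vertices are kept
   so as not to exceed the size 2 * t allowed to X. *)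
have cQ : clique f ((X :\: Y) :|: A).
  apply: clique_setU => //; last by case: bk.
  by apply: clique_sub cX; rewrite subsetDl.
have dis : #|(X :\: Y) :|: A| = #|X :\: Y| + #|A|.
  rewrite cardsU (_ : _ :&: A = set0) ?cards0 ?subn0 //.
  apply/setP => v; rewrite !inE; apply/negP => /andP[/andP[_ vX] /(subsetP AC)].
  by move=> /(subsetP CXW); rewrite inE vX.
have [Q QQ cardQ] : exists2 Q : {set T}, Q \subset (X :\: Y) :|: A & #|Q| = #|X|.+1.
  apply: subset_of_card; rewrite dis cXY cA.
  have := subset_leq_card YX; clear -cY; lia.
have : P Q.
  apply/and3P; split; last by rewrite cardQ.
    apply: subset_trans QQ _; rewrite subUset (subset_trans AC) // andbT.
    exact: subset_trans (subsetDl _ _) XW.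
  by apply/asboolP; apply: clique_sub cQ.
by move=> /Xmax /=; rewrite cardQ ltnn.
Qed.

(** * Embedding graphs of bounded degree *)

Definition embeds (T : finType) (e : rel T) (H : sgraph) (W : {set T}) : Prop :=
  exists f : H -> T, [/\ injective f, forall x, f x \in W &
    forall x y, edge x y -> e (f x) (f y)].

Lemma embeds_sub (T : finType) (e : rel T) (H : sgraph) (V W : {set T}) :
  V \subset W -> embeds e H V -> embeds e H W.
Proof. by move=> /subsetP VW [f [fi fV fe]]; exists f; split=> // x; apply: VW. Qed.

Lemma leq_card_bigcup (T I : finType) (P : pred I) (F : I -> {set T}) :
  #|\bigcup_(i | P i) F i| <= \sum_(i | P i) #|F i|.
Proof.
elim/big_rec2: _ => [|i n A _ IH]; first by rewrite cards0.
by apply: leq_trans (leq_card_setU _ _) _; rewrite leq_add2l.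
Qed.

(** Embed [H] greedily, keeping for each vertex still to be placed the set of
    its candidates, the common neighbours of the images placed so far.  If every
    placed neighbour divides a candidate set by at most [2 ^ a], all candidate sets
    stay large.  A vertex is impossible to place only if most of its candidates
    would shrink some other candidate set by more than that, and these two sets
    form a sparse pair. *)
Lemma embeds_or_sparse_pair (T : finType) (e : rel T) (es : symmetric e) (H : sgraph)
    a d (W : {set T}) :
  2 ^ (a * max_degree H) * (#|H| + (max_degree H).+1 * d) <= #|W| ->
  embeds e H W \/
  exists A B : {set T}, [/\ A \subset W, B \subset W, d <= #|A|, d <= #|B| &
    {in A, forall x, 2 ^ a * deg_in e B x < #|B|}].
Proof.
set D := max_degree H => big.
have [sp|nsp] := pselect (exists A B : {set T}, [/\ A \subset W, B \subset W,
    d <= #|A|, d <= #|B| & {in A, forall x, 2 ^ a * deg_in e B x < #|B|}]).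
  by right.
left.
case: (pickP (mem [set: H])) => [h0 _|H0]; last first.
  have no (x : H) : False by have := H0 x; rewrite /= inE.
  by exists (fun x => False_rect _ (no x)); split=> x; case: (no x).
have D0 : 0 < 2 ^ (a * D) by rewrite expn_gt0.
have [x0 x0W] : exists x, x \in W.
  apply/card_gt0P; apply: leq_trans big; rewrite muln_gt0 D0 addn_gt0.
  by apply/orP; left; apply/card_gt0P; exists h0.
pose cand (f : H -> T) (S : {set H}) v :=
  [set x in W | [forall (u | u \in S), edge u v ==> e (f u) x]].
pose ndone (S : {set H}) v := #|[set u in S | edge v u]|.
have ndoneD S v : ndone S v <= D.
  apply: (@leq_trans (degree v)); last by rewrite /D /max_degree; exact: leq_bigmax.
  by apply: subset_leq_card; apply/subsetP => u; rewrite !inE => /andP[].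
suff main n : n <= #|H| -> exists (S : {set H}) (f : H -> T), [/\ #|S| = n,
    {in S &, injective f}, {in S, forall u, f u \in W},
    {in S &, forall u v, edge u v -> e (f u) (f v)} &
    forall v, v \notin S -> #|W| <= 2 ^ (a * ndone S v) * #|cand f S v|].
  have [S [f [cS fi fW fe _]]] := main #|H| (leqnn _).
  have ST x : x \in S.
    suff -> : S = setT by [].
    by apply/eqP; rewrite eqEcard subsetT cardsT cS leqnn.
  exists f; split=> [u v|u|u v uv]; [exact: fi|exact: fW|exact: fe].
elim: n => [_|n IH nH].
  exists set0, (fun=> x0); split; rewrite ?cards0 //; do ?by move=> ?; rewrite inE.
  move=> v _; rewrite /ndone (_ : [set u in set0 | _] = set0) ?cards0; last first.
    by apply/setP => u; rewrite !inE.
  rewrite muln0 mul1n; apply: subset_leq_card; apply/subsetP => x xW.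
  by rewrite inE xW; apply/forallP => u; rewrite inE.
have [S [f [cS fi fW fe fc]]] := IH (ltnW nH).
have [v vS] : exists v, v \notin S.
  apply/existsP; apply: contraLR nH => /existsPn nv; rewrite -leqNgt -cS.
  by rewrite -cardsT; apply: subset_leq_card; apply/subsetP => v _; apply/negPn/nv.
have candbig u : u \notin S -> #|H| + D.+1 * d <= #|cand f S u|.
  move=> uS; rewrite -(leq_pmul2l D0); apply: leq_trans big _.
  apply: leq_trans (fc u uS) _; rewrite leq_mul2r leq_exp2l // leq_mul2l.
  by rewrite ndoneD !orbT.
pose bad u := [set x in cand f S v | 2 ^ a * deg_in e (cand f S u) x < #|cand f S u|].
have badd u : u \notin S -> #|bad u| <= d.
  move=> uS; rewrite leqNgt; apply/negP => /ltnW db; apply: nsp.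
  exists (bad u), (cand f S u); split=> //.
  - by apply/subsetP => x; rewrite !inE -andbA => /andP[].
  - by apply/subsetP => x; rewrite !inE => /andP[].
  - apply: leq_trans (candbig u uS); nia.
  - by move=> x; rewrite !inE => /andP[].
(* Images already used, and images that would shrink some candidate set too much. *)
pose allbad := f @: S :|: \bigcup_(u | (u \notin S) && edge v u) bad u.
have cbad : #|allbad| < #|cand f S v|.
  apply: leq_ltn_trans (leq_card_setU _ _) _.
  apply: (@leq_trans (#|H| + D.+1 * d)); last exact: candbig.
  rewrite -addSn leq_add //.
    by apply: leq_trans nH; rewrite ltnS -cS leq_imset_card.
  apply: leq_trans (leq_card_bigcup _ _) _.
  apply: (@leq_trans (\sum_(u | (u \notin S) && edge v u) d)).
    by apply: leq_sum => u /andP[uS _]; apply: badd.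
  rewrite sum_nat_const leq_mul2r; apply/orP; right.
  apply: (@leq_trans (degree v)).
    by apply: subset_leq_card; apply/subsetP => u; rewrite !inE => /andP[].
  by apply: leqW; rewrite /D /max_degree; exact: leq_bigmax.
have [x xc xb] : exists2 x, x \in cand f S v & x \notin allbad.
  apply/exists_inP; apply: contraLR cbad => /exists_inPn nb.
  by rewrite -leqNgt; apply/subset_leq_card/subsetP => x /nb /negPn.
move: xb; rewrite inE negb_or => /andP[xf xb].
have xW : x \in W by move: xc; rewrite inE => /andP[].
have xe u : u \in S -> edge u v -> e (f u) x.
  by move: xc; rewrite inE => /andP[_ /forall_inP h] uS; apply/implyP/h.
have neS u : u \in S -> (u == v) = false.
  by move=> uS; apply/negP => /eqP uv; rewrite -uv uS in vS.
exists (v |: S), (fun u => if u == v then x else f u); split.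
- by rewrite cardsU1 vS cS.
- move=> u1 u2 /setU1P[->|u1S] /setU1P[->|u2S] //; rewrite ?eqxx ?neS //.
  + by move=> xE; case/imsetP: xf; exists u2.
  + by move=> xE; case/imsetP: xf; exists u1.
  + exact: fi.
- by move=> u /setU1P[->|uS]; rewrite ?eqxx ?neS //; apply: fW.
- move=> u1 u2 /setU1P[->|u1S] /setU1P[->|u2S]; rewrite ?edge_irrefl ?eqxx ?neS //.
  + by rewrite es edge_sym; apply: xe.
  + by apply: xe.
  + exact: fe.
move=> w; rewrite inE inE negb_or => /andP[wv wS].
have candE : cand (fun u => if u == v then x else f u) (v |: S) w =
    [set y in cand f S w | edge v w ==> e x y].
  apply/setP => y; rewrite !inE -andbA; congr (_ && _); apply/idP/andP.
    move=> /forall_inP h; split.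
      by apply/forall_inP => u uS; have := h u; rewrite inE uS orbT neS //; apply.
    by have := h v; rewrite !inE eqxx; apply.
  move=> [/forall_inP h hv]; apply/forall_inP => u /setU1P[->|uS].
    by rewrite eqxx.
  by rewrite neS //; apply: h.
have doneE : ndone (v |: S) w = edge v w + ndone S w.
  rewrite /ndone (cardsD1 v) !inE eqxx /= edge_sym; congr (_ + _).
  apply: eq_card => u; rewrite !inE; case: (eqVneq u v) => //= ->.
  by rewrite (negPf vS).
rewrite candE doneE; have [vw|nvw] := boolP (edge v w); last first.
  rewrite (_ : [set y in cand f S w | _] = cand f S w); first exact: fc.
  by apply/setP => y; rewrite !inE /= andbT.
have : #|cand f S w| <= 2 ^ a * deg_in e (cand f S w) x.
  rewrite leqNgt; apply: contra xb => xbad.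
  by apply/bigcupP; exists w; rewrite ?wS ?vw // inE xc.
rewrite /= add1n mulnS expnD => cw; apply: leq_trans (fc w wS) _.
by rewrite mulnAC [leqRHS]mulnC leq_mul2l cw orbT.
Qed.

Lemma sum_setU (T : finType) (A B : {set T}) (F : T -> nat) :
  [disjoint A & B] ->
  \sum_(x in A :|: B) F x = \sum_(x in A) F x + \sum_(x in B) F x.
Proof.
move=> AB; rewrite -(bigU (mem A) (mem B)) //.
by apply: eq_bigl => x; rewrite !inE.
Qed.

Lemma deg_in_setU (T : finType) (e : rel T) (A B : {set T}) x :
  [disjoint A & B] -> deg_in e (A :|: B) x = deg_in e A x + deg_in e B x.
Proof. by move=> AB; rewrite !deg_in_sum sum_setU. Qed.

Lemma adjacent_pairs_setU (T : finType) (e : rel T) (es : symmetric e) (A B : {set T}) :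
  [disjoint A & B] ->
  adjacent_pairs e (A :|: B) =
    adjacent_pairs e A + adjacent_pairs e B + 2 * \sum_(x in B) deg_in e A x.
Proof.
move=> AB; rewrite /adjacent_pairs sum_setU //.
rewrite (eq_bigr _ (fun x _ => deg_in_setU e x AB)).
rewrite (eq_bigr _ (fun x _ => deg_in_setU e x AB)) !big_split /=.
by rewrite [X in _ + X + _](deg_in_double_count es); lia.
Qed.

(** Split [W] by a sparse pair and recurse into both sides [h] times: the result
    consists of [2 ^ h] blocks of size [s] with few edges between them, so its
    density is about [2 ^ (- h)] from the blocks plus [2 * 2 ^ (- a)] from the
    pairs. *)
Lemma sparse_subset (T : finType) (e : rel T) (es : symmetric e) (H : sgraph) a s h
    (W : {set T}) :
  #|H| <= s -> 0 < s -> 2 ^ (h * (a.+1 * max_degree H + 3)) * s <= #|W| ->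
  embeds e H W \/
  exists S : {set T}, [/\ S \subset W, #|S| = 2 ^ h * s &
    2 ^ a * adjacent_pairs e S <= 2 ^ (a + h) * s ^ 2 + 2 * 4 ^ h * s ^ 2].
Proof.
set D := max_degree H; set c := _ + 3 => Hs s0.
elim: h W => [|h IH] W.
  rewrite mul0n expn0 mul1n => sW; right; have [S SW cS] := subset_of_card sW.
  exists S; rewrite cS; split=> //; rewrite addn0.
  have : adjacent_pairs e S <= s ^ 2.
    apply: (@leq_trans (\sum_(x in S) s)).
      apply: leq_sum => x _; rewrite -cS; apply: subset_leq_card.
      by apply/subsetP => y; rewrite inE => /andP[].
    by rewrite sum_nat_const cS mulnn.
  have := expn_gt0 2 a; nia.
move=> big; set w := 2 ^ (h * c) * s in IH.
have w_s : s <= w by rewrite leq_pmull // expn_gt0.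
have [|emb|] := @embeds_or_sparse_pair T e es H a (4 * w) W.
- apply: leq_trans big; rewrite (mulSn h) expnD -mulnA -/w /c expnD (mulSn a) expnD.
  have D2 : D.+2 <= 2 * 2 ^ D by clear; elim: D => // d; rewrite expnS; lia.
  rewrite -/D -[2 ^ 3]/8.
  have : #|H| + D.+1 * (4 * w) <= 2 ^ D * 8 * w.
    have := leq_mul D2 (leqnn (4 * w)); lia.
  move=> /(leq_mul (leqnn (2 ^ (a * D)))); lia.
- by left.
move=> [A [B [AW BW dA dB AB]]].
case: (IH A); first by lia.
  by move=> emb; left; apply: embeds_sub emb.
move=> [S1 [S1A cS1 eS1]].
have S1s : #|S1| <= w.
  rewrite cS1 leq_mul2r leq_exp2l // orbC leq_pmulr // /c; lia.
(* A vertex of B sees S1 with density 2^(-a) on average; half of B has at most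
   twice that, and only this half is searched for the second side. *)
set q := 2 * #|S1|.
set B1 := [set v in B | 2 ^ a * deg_in e S1 v <= q].
have B1big : #|B| <= 2 * #|B1|.
  have := card_split B (fun v => 2 ^ a * deg_in e S1 v <= q); rewrite -/B1.
  have -> : [set v in B | ~~ (2 ^ a * deg_in e S1 v <= q)] =
            [set v in B | q < 2 ^ a * deg_in e S1 v].
    by apply/setP => v; rewrite !inE ltnNge.
  have := @card_above_le T B (fun v => 2 ^ a * deg_in e S1 v) q (#|S1| * #|B|).
  have -> : \sum_(x in B) 2 ^ a * deg_in e S1 x <= #|S1| * #|B|.
    rewrite -big_distrr /= (deg_in_double_count es) big_distrr /= -sum_nat_const.
    by apply: leq_sum => x /(subsetP S1A) /AB /ltnW.
  have S10 : 0 < #|S1| by rewrite cS1 muln_gt0 expn_gt0.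
  move=> /(_ isT); rewrite -/q; set b := #|[set _ in _ | q < _]| => bw.
  have : 2 * b <= #|B| by rewrite /q in bw; nia.
  lia.
have B2big : w <= #|B1 :\: S1|.
  have : #|B1| <= #|B1 :\: S1| + #|S1|.
    by rewrite -(cardsID S1 B1) addnC leq_add2l subset_leq_card // subsetIr.
  lia.
have B2B : B1 :\: S1 \subset B.
  by apply/subsetP => v; rewrite !inE => /and3P[].
case: (IH _ B2big).
  by move=> emb; left; apply: embeds_sub emb; apply: subset_trans BW.
move=> [S2 [S2B cS2 eS2]]; right; exists (S1 :|: S2).
have dis : [disjoint S1 & S2].
  rewrite disjoint_sym; apply/pred0P => v /=; apply/negP => /andP[/(subsetP S2B)].
  by rewrite !inE => /andP[/negPf->].
split.
- by rewrite subUset (subset_trans S1A) // (subset_trans S2B) // (subset_trans B2B).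
- by rewrite cardsU disjoint_setI0 // cards0 subn0 cS1 cS2 expnS; lia.
have cross : 2 ^ a * \sum_(x in S2) deg_in e S1 x <= #|S2| * q.
  rewrite big_distrr /= -sum_nat_const; apply: leq_sum => x /(subsetP S2B).
  by rewrite !inE => /and3P[].
rewrite adjacent_pairs_setU // /q cS1 cS2 in cross *.
have E4 : 4 ^ h = 2 ^ h * 2 ^ h by rewrite -expnMn.
rewrite addnS !expnS in eS1 eS2 *; rewrite E4 in eS1 eS2 *.
set p := 2 ^ h in eS1 eS2 cross *; nia.
Qed.

(** * One amplification step *)

Lemma sixteen_le_expn4 y : 3 <= y -> 16 * y <= 4 ^ y.
Proof.
case: y => [|[|[|y]]] // _; elim: y => // y IH.
by rewrite expnS; move: IH; lia.
Qed.

Lemma square_le_expn8 y : 3 <= y -> 512 * (y * y) <= 9 * 8 ^ y.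
Proof.
case: y => [|[|[|y]]] // _; elim: y => // y IH.
by rewrite expnS; move: IH; nia.
Qed.

(** The exponents lost in one step: the first summand comes from
    [sparse_subset], the next two from the binomial coefficients of [sparse_book].
    With [D] of order [M / y ^ 3] and [z] of order [M / 8 ^ y], all are
    [O(M / y)]. *)
Lemma step_cost M y D z : 9 <= M -> 3 <= y -> y * y <= M -> D * y ^ 3 <= 2 * M ->
  2 ^ (5 * y) * z <= 16 * (4 ^ y.+1 * M) -> z <= 4 ^ y.+1 * M ->
  (5 * y).+1 * ((5 * y).+3 * D + 3)
   + (4 * y * z.+1 + 2 * ((4 ^ y.+1 * M + z.+1) %/ 2 ^ (4 * y)).+1)
   + (4 * y * z + 2 * ((2 * (4 ^ y.+1 * M) + z) %/ 2 ^ (4 * y)).+1) + 3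
  <= (198 * M) %/ y.
Proof.
move=> M9 y3 yM DM zM zt.
rewrite leq_divRL; last by lia.
have E4 : 4 ^ y.+1 = 4 * 4 ^ y by rewrite expnS.
have E8 : 2 ^ (5 * y) = 8 ^ y * 4 ^ y.
  by rewrite -expnMn -(expnM 2 5 y).
have E16 : 2 ^ (4 * y) = 4 ^ y * 4 ^ y by rewrite -expnMn -(expnM 2 4 y).
rewrite E4 E8 in zM zt *; rewrite E16.
have q16 := sixteen_le_expn4 y3; have q8 := square_le_expn8 y3.
set q := 4 ^ y in zM zt q16 *; set p := 8 ^ y in zM q8 *.
have q0 : 0 < q by lia.
have p0 : 0 < p by lia.
have pz : p * z <= 64 * M by rewrite -(leq_pmul2l q0); lia.
have yz : 8 * (y * y) * z <= 9 * M.
  rewrite -(leq_pmul2l p0).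
  have := leq_mul q8 pz; lia.
have qqM : y * (16 * (q * M)) <= M * (q * q) by have := leq_mul q16 (leqnn (q * M)); lia.
have qM : 0 < q * M by rewrite muln_gt0 q0; lia.
have quot n : n <= 16 * (q * M) -> y * (n %/ (q * q)) <= M.
  move=> nq; have qq : 0 < q * q by rewrite muln_gt0 q0.
  rewrite -(leq_pmul2r qq) -mulnA; apply: leq_trans qqM.
  by rewrite leq_mul2l (leq_trans (leq_trunc_div _ _) nq) orbT.
have d1 : y * (((4 * q * M) + z.+1) %/ (q * q)) <= M by apply: quot; lia.
have d2 : y * ((2 * (4 * q * M) + z) %/ (q * q)) <= M by apply: quot; lia.
set d := _ %/ _ in d1 *; set d' := _ %/ _ in d2 *.
have yy : 3 * y <= y * y by rewrite leq_mul2r y3 orbT.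
have Dy : (5 * y).+1 * (5 * y).+3 * D * y <= 64 * M.
  have : (5 * y).+1 * (5 * y).+3 <= 32 * (y * y) by lia.
  move=> /leq_mul /(_ (leqnn (D * y))); rewrite !expnS expn0 in DM; lia.
have h1 : y * (5 * y).+1 * 3 <= 16 * M by lia.
lia.
Qed.

(** Any injection of [U] into the spine will do: every pair that meets the spine
    already has the right colour. *)
Lemma book_embeds (T : finType) (e : rel T) (es : symmetric e) (ei : irreflexive e)
    (G : sgraph) (U : {set G}) (A B : {set T}) :
  book e A B -> #|U| <= #|A| -> embeds e (delete U) B -> embeds e G [set: T].
Proof.
move=> [cA AB] /subset_of_card[A' A'A cA'] [g [gi gB ge]].
pose h (x : G) (xU : x \in U) := enum_val (cast_ord (esym cA') (enum_rank_in xU x)).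
have hA x xU : h x xU \in A by apply: (subsetP A'A); apply: enum_valP.
have hi x y xU yU : h x xU = h y yU -> x = y.
  by move=> /enum_val_inj /cast_ord_inj; apply: enum_rank_in_inj.
have dec x : {x \in U} + {x \notin U} by case: (boolP (x \in U)) => xU; [left | right].
pose f (x : G) : T := match dec x with
  | left xU => h x xU | right xU => g (exist _ x xU) end.
have fP x : (exists xU, f x = h x xU) \/ (exists xU, f x = g (exist _ x xU)).
  by rewrite /f; case: (dec x) => xU; [left; exists xU | right; exists xU].
have neq x y (xU : x \in U) yU : h x xU != g (exist _ y yU).
  apply/eqP => xy; have := AB _ _ (hA x xU) (gB (exist _ y yU)).
  by rewrite -xy ei.
exists f; split=> [x y | x | x y xy]; rewrite ?inE //.
  case: (fP x) => [[xU ->]|[xU ->]]; case: (fP y) => [[yU ->]|[yU ->]].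
  - exact: hi.
  - by move=> xy; have := neq x y xU yU; rewrite xy eqxx.
  - by move=> xy; have := neq y x yU xU; rewrite xy eqxx.
  - by move=> /gi [].
case: (fP x) => [[xU ->]|[xU ->]]; case: (fP y) => [[yU ->]|[yU ->]].
- apply: cA => //; apply/eqP => /hi xyE.
  by move: xy; rewrite xyE edge_irrefl.
- exact: AB.
- by rewrite es; apply: AB.
- exact: ge.
Qed.

(** One round of the amplification.  The book feeds the absence of [G] into
    [sparse_subset] with density [2 ^ (- 5 * y)]; this is small enough for the
    target [t = 4 ^ y.+1 * M] of [sparse_book] to cost only [O(M / y)] bits. *)
Lemma book_step (T : finType) (e f : rel T) (es : symmetric e) (fs : symmetric f)
    (ei : irreflexive e) (ef : forall x y, x != y -> e x y || f x y)
    (G : sgraph) (U : {set G}) M y E (A B : {set T}) :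
  9 <= M -> 3 <= y -> y * y <= M -> 4 ^ y <= M * M ->
  #|G| <= 2 ^ (19 * M) -> #|U| <= #|A| -> max_degree (delete U) * y ^ 3 <= 2 * M ->
  36 * M <= E -> book e A B -> 2 ^ (E + 198 * M %/ y) <= #|B| ->
  [\/ embeds e G [set: T],
      exists A' B' : {set T}, [/\ #|A'| = 4 ^ y.+1 * M, 2 ^ E <= #|B'| & book e A' B'] |
      exists A' B' : {set T}, [/\ #|A'| = 4 ^ y.+1 * M, 2 ^ E <= #|B'| & book f A' B']].
Proof.
move=> M9 y3 yM y4 GM UA DM EM bk Bbig.
set t := 4 ^ y.+1 * M.
(* 2^(-k) is the density aimed at: since 2^k = 8^y * 4^y, z is at most 64 * M / 8^y. *)
set k := 5 * y; set z := (16 * t) %/ 2 ^ k.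
set D := max_degree (delete U) in DM.
have p0 : 0 < 2 ^ k by rewrite expn_gt0.
have zt' : 2 ^ k * z <= 16 * t by rewrite mulnC leq_trunc_div.
have zt : z <= t.
  have : 16 <= 2 ^ k by rewrite -[16]/(2 ^ 4) leq_exp2l // /k; lia.
  rewrite -(leq_pmul2l (isT : 0 < 16)); nia.
have cost := step_cost M9 y3 yM DM zt' zt.
set c := (5 * y).+3 * D + 3 in cost.
set b1 := 4 * y * z.+1 + _ in cost; set b2 := 4 * y * z + _ in cost.
set C := 198 * M %/ y in Bbig cost.
set s := 2 ^ (E + C - k.+1 * c).
have hcC : k.+1 * c <= C by apply: leq_trans cost; clear; lia.
have bcC : 3 + b1 + b2 <= C - k.+1 * c.
  by rewrite leq_subRL //; apply: leq_trans cost; clear; lia.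
have y40 : 0 < 4 * y by clear -y3; lia.
have B1 : 'C(t + z.+1, z.+1) <= 2 ^ b1 := bin_le_expn (t + z.+1) z.+1 y40.
have B2 : 'C(2 * t + z, z) <= 2 ^ b2 := bin_le_expn (2 * t + z) z y40.
clearbody C b1 b2.
have UG : #|delete U| <= s.
  apply: (@leq_trans #|G|); first by rewrite card_sig; apply: max_card.
  by apply: leq_trans GM _; rewrite leq_exp2l //; clear -hcC EM M9; lia.
have [||emb|[S [SB cS sS]]] := @sparse_subset T e es (delete U) k.+2 s k.+1 B UG.
- by rewrite expn_gt0.
- rewrite -/D -/c -expnD subnKC //.
  exact: leq_trans hcC (leq_addl _ _).
- by constructor 1; exact: (book_embeds es ei bk UA emb).
have s0 : 0 < s by rewrite expn_gt0.
have sparse : 2 ^ k * adjacent_pairs e S <= #|S| ^ 2.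
  rewrite cS expnMn -(leq_pmul2l (isT : 0 < 4)); move: sS.
  have -> : 4 ^ k.+1 = (2 ^ k.+1) ^ 2 by rewrite -expnM mulnC expnM.
  by rewrite expnD !expnS; lia.
have t0 : 0 < t by rewrite muln_gt0 expn_gt0; lia.
have tz : 16 * t < 2 ^ k * z.+1 by rewrite [ltnRHS]mulnC ltn_ceil.
have big : 4 * (2 * t + 2 ^ E * 'C(t + z.+1, z.+1) * 'C(2 * t + z, z)) <= #|S|.
  (* t is at most cubic in M, hence negligible against 2^E. *)
  have tE : 2 * t <= 2 ^ E.
    apply: (@leq_trans (2 ^ (36 * M))); last by rewrite leq_exp2l.
    rewrite /t expnS.
    have M2 : M <= 2 ^ M by rewrite ltnW // ltn_expl.
    apply: (@leq_trans (2 ^ 3 * (2 ^ M * 2 ^ M * 2 ^ M))).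
      have := leq_mul (leq_mul M2 M2) M2; have := leq_mul y4 (leqnn M).
      rewrite -[2 ^ 3]/8; move: (2 ^ M) (4 ^ y); clear; lia.
    by rewrite -!expnD leq_exp2l //; clear -M9; lia.
  apply: (@leq_trans (2 ^ (E + b1 + b2 + 3))).
    have h1 := leq_mul (leq_mul (leqnn (2 ^ E)) B1) B2.
    rewrite -!expnD in h1.
    have h2 : 2 * t <= 2 ^ (E + b1 + b2) by apply: leq_trans tE _; rewrite leq_exp2l // -addnA leq_addr.
    rewrite expnD -[2 ^ 3]/8; move: h1 h2; rewrite [_ * 8]mulnC.
    set u := 2 ^ E * 'C(_, _) * 'C(_, _); set v := 2 ^ (E + b1 + b2).
    move: u v => u v; clear; lia.
  rewrite cS -expnD leq_exp2l //; move: bcC hcC; move: (k.+1 * c) (k.+1); clear; lia.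
have E0 : 0 < 2 ^ E by rewrite expn_gt0.
case: (sparse_book es fs ef E0 t0 zt tz sparse big) => [] [A' [C' [_ _ cA' EC bk']]].
  by constructor 2; exists A', C'.
by constructor 3; exists A', C'.
Qed.

(** * Iterating the step *)

Lemma contains_copyP N (c : {ffun {set 'I_N} -> bool}) b (G : sgraph) :
  reflect (embeds (colour_edge c b) G [set: 'I_N]) (contains_copy (colour_graph c b) G).
Proof.
apply: (iffP existsP) => [[f /andP[/injectiveP fi fe]]|[f [fi _ fe]]].
  exists f; split=> // x y; by move: fe => /forallP/(_ x)/forallP/(_ y)/implyP.
exists (finfun f); apply/andP; split.
  by apply/injectiveP => x y; rewrite !ffunE; apply: fi.
apply/forallP => x; apply/forallP => y; apply/implyP => xy; rewrite !ffunE.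
exact: fe.
Qed.

Lemma ramsey_le G1 G2 N : 0 < N -> arrows G1 G2 N -> ramsey G1 G2 <= N.
Proof. by move=> N0 aN; rewrite /ramsey; case: ex_minnP => n _; apply; rewrite N0. Qed.

(** Transfer of the Ramsey property to subsets of a larger coloured complete
    graph, by pulling the colouring back along an enumeration. *)
Lemma ramsey_embeds G1 G2 N (c : {ffun {set 'I_N} -> bool}) (B : {set 'I_N}) :
  ramsey G1 G2 <= #|B| ->
  embeds (colour_edge c true) G1 B \/ embeds (colour_edge c false) G2 B.
Proof.
rewrite /ramsey; case: ex_minnP => n /andP[_ an] _ nB.
pose h (i : 'I_n) := enum_val (widen_ord nB i).
have hi : injective h by move=> i j /enum_val_inj/(congr1 val) /= ij; apply: val_inj.
have hB i : h i \in B by apply: enum_valP.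
pose c' := [ffun S : {set 'I_n} => c (h @: S)].
have pull b (G : sgraph) : contains_copy (colour_graph c' b) G ->
    embeds (colour_edge c b) G B.
  move=> /contains_copyP[f [fi _ fe]]; exists (h \o f); split=> [|x|x y xy] /=.
  - exact: inj_comp.
  - exact: hB.
  have := fe x y xy; rewrite /colour_edge ffunE imsetU1 imset_set1.
  by rewrite (inj_eq hi).
by have /forallP/(_ c')/orP[/pull|/pull] := an; [left | right].
Qed.

Lemma bin_le_exp2 n k : 'C(n, k) <= 2 ^ n.
Proof.
have [kn|kn] := leqP k n; last by rewrite bin_small.
rewrite -[2]/(1 + 1) expnDn (bigD1 (inord k)) //= inordK ?ltnS //.
by rewrite !exp1n !muln1 leq_addr.
Qed.

Lemma cube_le_expn4 y : 3 <= y -> 2 * y ^ 3 <= 4 ^ y.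
Proof.
case: y => [|[|[|y]]] // _; elim: y => // y IH.
rewrite [4 ^ _]expnS; move: IH; rewrite !expnS !expn0; set q := 4 ^ y; nia.
Qed.

(** Ensures that terms of order [y ^ 2] in the cost of a step, among them those
    due to rounding, are absorbed by [M]. *)
Lemma square_le_of_expn4 M y : 9 <= M -> 3 <= y -> 4 ^ y <= M * M -> y * y <= M.
Proof.
move=> M9 y3 yM; have [->|y4] : y = 3 \/ 4 <= y by lia.
  by [].
have yy : y * y <= 2 ^ y.
  move: y4; clear; case: y => [|[|[|[|y]]]] // _; elim: y => // y IH.
  by rewrite expnS; move: IH; lia.
apply: leq_trans yy _.
by rewrite -(leq_exp2r _ _ (isT : 0 < 2)) -expnM mulnC expnM -[M ^ 2]mulnn.
Qed.

(** The whole combinatorial argument, in integers: [M] is [sqrt m] rounded up and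
    [y ^ 3] runs through values of the parameter alpha. *)
Lemma ramsey_le_exp (G1 G2 : sgraph) M Y :
  9 <= M -> 3 <= Y -> 4 ^ Y <= M * M ->
  #|G1| <= 2 ^ (19 * M) -> #|G2| <= 2 ^ (19 * M) ->
  (forall y, 3 <= y <= Y -> exists U : {set G1},
     #|U| <= y ^ 3 * M /\ max_degree (delete U) * y ^ 3 <= 2 * M) ->
  (forall y, 3 <= y <= Y -> exists U : {set G2},
     #|U| <= y ^ 3 * M /\ max_degree (delete U) * y ^ 3 <= 2 * M) ->
  (exists2 V : {set G1}, #|V| <= 4 ^ Y.+1 * M & ramsey (delete V) G2 <= 2 ^ (36 * M)) ->
  (exists2 V : {set G2}, #|V| <= 4 ^ Y.+1 * M & ramsey G1 (delete V) <= 2 ^ (36 * M)) ->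
  ramsey G1 G2 <= 2 ^ (222 * M).
Proof.
move=> M9 Y3 YM c1 c2 U1 U2 [V1 cV1 R1] [V2 cV2 R2].
apply: ramsey_le; first by rewrite expn_gt0.
set N := 2 ^ (222 * M); apply/forallP => c; apply: contraT; rewrite negb_or.
move=> /andP[/contains_copyP n1 /contains_copyP n2].
pose G b := if b then G1 else G2.
have nG b : ~ embeds (colour_edge c b) (G b) [set: 'I_N] by case: b.
have cG b : #|G b| <= 2 ^ (19 * M) by case: b.
have UG b y : 3 <= y <= Y -> exists U : {set G b},
    #|U| <= y ^ 3 * M /\ max_degree (delete U) * y ^ 3 <= 2 * M.
  by case: b; [exact: U1 | exact: U2].
have es b : symmetric (colour_edge c b) := @colour_edge_sym N c b.
have ei b : irreflexive (colour_edge c b) := @colour_edge_irrefl N c b.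
have ef b x y : x != y -> colour_edge c b x y || colour_edge c (~~ b) x y.
  by rewrite /colour_edge => ->; case: (c _); case: b.
have step b y E A B : 3 <= y <= Y -> book (colour_edge c b) A B ->
    y ^ 3 * M <= #|A| -> 36 * M <= E -> 2 ^ (E + 198 * M %/ y) <= #|B| ->
    exists b' A' B', [/\ book (colour_edge c b') A' B', #|A'| = 4 ^ y.+1 * M &
      2 ^ E <= #|B'|].
  move=> yY bk cA EM cB; have [U [cU DU]] := UG b y yY.
  have /andP[y3 yY'] := yY.
  have y4 : 4 ^ y <= M * M by apply: leq_trans YM; rewrite leq_exp2l.
  have yyM := square_le_of_expn4 M9 y3 y4.
  have [/nG//|[A' [B' [cA' cB' bk']]]|[A' [B' [cA' cB' bk']]]] :=
    book_step (es b) (es (~~ b)) (ei b) (@ef b) M9 y3 yyM y4 (cG b)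
      (leq_trans cU cA) DU EM bk cB.
    by exists b, A', B'.
  by exists (~~ b), A', B'.
have final b A B : book (colour_edge c b) A B -> 4 ^ Y.+1 * M <= #|A| ->
    2 ^ (36 * M) <= #|B| -> False.
  case: b => bk cA cB.
    have [em|em] := ramsey_embeds c (leq_trans R1 cB).
      by apply: n1; apply: (book_embeds (es true) (ei true) bk (leq_trans cV1 cA) em).
    by apply: n2; apply: embeds_sub em; apply: subsetT.
  have [em|em] := ramsey_embeds c (leq_trans R2 cB).
    by apply: n1; apply: embeds_sub em; apply: subsetT.
  by apply: n2; apply: (book_embeds (es false) (ei false) bk (leq_trans cV2 cA) em).
have chain n y b A B : Y - y < n -> 3 <= y <= Y -> book (colour_edge c b) A B ->
    y ^ 3 * M <= #|A| -> 2 ^ (36 * M + (396 * M) %/ y) <= #|B| -> False.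
  elim: n => // n IH in y b A B *.
  move=> yn yY bk cA cB; have /andP[y3 yY'] := yY.
  (* A step from y costs half of the reserve 396 * M / y; the other half pays for
     all later steps if y doubles, and for the single last one at Y otherwise. *)
  have twice : 198 * M %/ y + 198 * M %/ y <= 396 * M %/ y.
    rewrite leq_divRL; last by lia.
    have := leq_trunc_div (198 * M) y; lia.
  have half : 396 * M %/ (2 * y) = 198 * M %/ y.
    by rewrite (_ : 396 * M = 2 * (198 * M)) ?divnMl //; lia.
  have cube := cube_le_expn4 y3.
  have [y2|y2] := leqP (2 * y) Y.
    have [||b' [A' [B' [bk' cA' cB']]]] :=
        step b y (36 * M + 396 * M %/ (2 * y)) A B yY bk cA.
    - exact: leq_addr.
    - by apply: leq_trans cB; rewrite leq_exp2l // -addnA leq_add2l half.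
    have lt : Y - 2 * y < n by clear -yn y2 y3; lia.
    have y2Y : 3 <= 2 * y <= Y by rewrite y2 andbT; clear -y3; lia.
    apply: (IH _ b' A' B' lt y2Y bk' _ cB').
    by rewrite cA' leq_mul2r expnMn [4 ^ _]expnS -[2 ^ 3]/8; apply/orP; right; clear -cube; lia.
  have [||b' [A' [B' [bk' cA' cB']]]] :=
      step b y (36 * M + 198 * M %/ Y) A B yY bk cA.
  - exact: leq_addr.
  - apply: leq_trans cB; rewrite leq_exp2l // -addnA leq_add2l.
    apply: leq_trans twice; rewrite leq_add2r; apply: leq_div2l => //; clear -y3; lia.
  have [||b2 [A2 [B2 [bk2 cA2 cB2]]]] := step b' Y (36 * M) A' B' _ bk' _ (leqnn _) cB'.
  - by rewrite Y3 leqnn.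
  - rewrite cA' leq_mul2r; apply/orP; right.
    apply: (@leq_trans ((2 * y) ^ 3)); first by rewrite leq_exp2r // ltnW.
    by rewrite expnMn [4 ^ _]expnS -[2 ^ 3]/8; clear -cube; lia.
  by apply: (final b2 A2 B2) => //; rewrite cA2.
have start b A B : book (colour_edge c b) A B -> #|A| = 27 * M ->
    2 ^ (168 * M) <= #|B| -> False.
  move=> bk cA cB; apply: (chain Y.+1 3 b A B) => //.
  - by rewrite ltnS leq_subr.
  - by rewrite cA.
  apply: leq_trans cB; rewrite leq_exp2l //.
  by rewrite (_ : 396 * M = 132 * M * 3) ?mulnK //; lia.
have [||[A [C [_ _ cA cC bk]]]|[A [C [_ _ cA cC bk]]]] :=
    @book_ramsey 'I_N (colour_edge c true) (colour_edge c false) (es true) (es false)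
    (@ef true) (2 ^ (168 * M)) (27 * M) (27 * M) setT.
- by rewrite expn_gt0.
- rewrite cardsT card_ord /N; have -> : 222 * M = 168 * M + (27 * M + 27 * M) by lia.
  by rewrite expnD leq_mul2l bin_le_exp2 orbT.
- by case: (start true A C).
- by case: (start false A C).
Qed.

(** * From real to integer parameters *)

Lemma expn18_add_le M : 9 <= M -> 2 ^ (18 * M) + 27 * M <= 2 ^ (19 * M).
Proof.
move=> M9; have h27 : 27 * M <= 2 ^ (18 * M).
  apply: (@leq_trans (2 ^ 5 * 2 ^ M)).
    by rewrite leq_mul // ltnW // ltn_expl.
  by rewrite -expnD leq_exp2l //; lia.
have M2 : 2 <= 2 ^ M by rewrite (leq_exp2l 1) //; lia.
rewrite (mulSn 18) expnD; have := leq_mul M2 (leqnn (2 ^ (18 * M))).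
move: h27; move: (2 ^ (18 * M)) (2 ^ M); clear; lia.
Qed.

Local Open Scope ring_scope.

Lemma nat_le_log2 (R : realType) (k m : nat) :
  (0 < m)%N -> (k%:R <= log2 m%:R :> R) = (2 ^ k <= m)%N.
Proof.
move=> m0; have l2 : 0 < ln 2 :> R by rewrite ln_gt0 // ltr1n.
rewrite /log2 ler_pdivlMr // mulr_natl -lnXn // ler_ln ?posrE ?exprn_gt0 ?ltr0n //.
by rewrite -natrX ler_nat.
Qed.

Lemma powR2_nat (R : realType) n : 2 `^ n%:R = (2 ^ n)%:R :> R.
Proof. by rewrite powR_mulrn // natrX. Qed.

Unset Implicit Arguments.

Theorem theorem1p4 (R : realType) (G1 G2 : sgraph) (n1 n2 m : nat)
  (order1 : #|G1| = n1) (order2 : #|G2| = n2)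
  (noiso1 : no_isolated G1) (noiso2 : no_isolated G2)
  (m_gt0 : (0 < m)%N)
  (n_le : 2 `^ (106 * Num.sqrt m%:R / log2 m%:R)
          >= (maxn n1 n2)%:R - 27 * Num.sqrt m%:R :> R)
  (range_ne : 27 <= log2 m%:R ^+ 3 / 8 :> R)
  (props : forall alpha : R, 27 <= alpha <= log2 m%:R ^+ 3 / 8 ->
    ((exists U1 : {set G1},
        #|U1|%:R <= alpha * Num.sqrt m%:R /\
        (max_degree (delete U1))%:R <= 2 * Num.sqrt m%:R / alpha)
     /\
     (exists U2 : {set G2},
        #|U2|%:R <= alpha * Num.sqrt m%:R /\
        (max_degree (delete U2))%:R <= 2 * Num.sqrt m%:R / alpha))
    /\
    (exists (V1 : {set G1}) (V2 : {set G2}),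
        [/\ #|V1|%:R <= (m%:R : R) `^ (3 / 2),
            #|V2|%:R <= (m%:R : R) `^ (3 / 2) &
            (maxn (ramsey (delete V1) G2) (ramsey G1 (delete V2)))%:R
              <= 2 `^ (36 * Num.sqrt m%:R) :> R])) :
  (ramsey G1 G2)%:R <= 2 `^ (250 * Num.sqrt m%:R) :> R.
Proof.
set L : R := log2 m%:R in n_le range_ne props.
set r : R := Num.sqrt m%:R in n_le props *.
have L0 : 0 <= L by rewrite -[0]/(0%:R) nat_le_log2.
have L6 : 6 <= L.
  rewrite -(@ler_pXn2r _ 3) ?nnegrE //; lra.
have m64 : (64 <= m)%N by have := nat_le_log2 R 6 m_gt0; rewrite L6 => <-.
have rr : r * r = m%:R by rewrite -expr2 sqr_sqrtr // ler0n.
have r0 : 0 <= r by apply: sqrtr_ge0.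
have r8 : 8 <= r.
  rewrite -(@ler_pXn2r _ 2) ?nnegrE // [r ^+ 2]expr2 rr.
  by rewrite -natrX ler_nat.
pose M := (Num.truncn r).+1.
have /andP[Mlow rM] := truncn_itv r0.
rewrite -/M in rM.
have M89 : 8 * M%:R <= 9 * r.
  by rewrite /M -natr1; lra.
have M9 : (9 <= M)%N.
  by rewrite -(ltr_nat R); apply: le_lt_trans rM.
have mMM : (m <= M * M)%N.
  by rewrite -(ler_nat R) natrM -rr ler_pM // ltW.
(* 4 ^ y <= m means 2 * y <= log m, that is y ^ 3 <= log^3 m / 8. *)
pose Y := trunc_log 4 m.
have /andP[Y4 Y4'] := trunc_log_bounds (isT : (1 < 4)%N) m_gt0.
rewrite -/Y in Y4 Y4'.
have Y3 : (3 <= Y)%N by rewrite trunc_log_max.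
have powM k : 2 `^ (k%:R * r) <= (2 ^ (k * M))%:R :> R.
  by rewrite -powR2_nat ler_powR ?ler1n // natrM ler_wpM2l // ltW.
(* As log m >= 6, the exponent 106 * r / L is at most 18 * r. *)
have order : (maxn n1 n2 <= 2 ^ (19 * M))%N.
  have h1 : (maxn n1 n2)%:R <= (2 ^ (18 * M) + 27 * M)%:R :> R.
    rewrite natrD natrM.
    have : 2 `^ (106 * r / L) <= (2 ^ (18 * M))%:R :> R.
      apply: le_trans (powM 18); rewrite ler_powR ?ler1n //.
      by rewrite ler_pdivrMr; nra.
    lra.
  rewrite ler_nat in h1; exact: leq_trans h1 (expn18_add_le _).
have alpha y : (3 <= y <= Y)%N -> 27 <= ((y ^ 3)%:R : R) <= L ^+ 3 / 8.
  move=> /andP[y3 yY]; rewrite -[27]/(27%:R) ler_nat (leq_exp2r 3 y (isT : 0 < 3)%N) y3 /=.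
  have : (2 * y)%:R <= L.
    by rewrite nat_le_log2 // expnM (leq_trans _ Y4) // leq_exp2l.
  move=> /(lerXn2r 3); rewrite !nnegrE L0 ler0n => /(_ isT isT).
  by rewrite natrM natrX exprMn; lra.
have UG (G : sgraph) y : (3 <= y)%N ->
    (exists U : {set G}, #|U|%:R <= (y ^ 3)%:R * r /\
        (max_degree (delete U))%:R <= 2 * r / (y ^ 3)%:R) ->
    exists U : {set G}, (#|U| <= y ^ 3 * M)%N /\ (max_degree (delete U) * y ^ 3 <= 2 * M)%N.
  move=> y3 [U [cU dU]]; exists U; split.
    rewrite -(ler_nat R) natrM; apply: le_trans cU _.
    by rewrite ler_wpM2l // ltW.
  have y0 : 0 < (y ^ 3)%:R :> R by rewrite ltr0n expn_gt0; case: (y) y3.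
  rewrite -(ler_nat R) natrM [(2 * M)%:R]natrM -ler_pdivlMr //; apply: le_trans dU _.
  by rewrite ler_pM2r ?invr_gt0 // ler_wpM2l // ltW.
have VG (G : sgraph) (V : {set G}) :
    #|V|%:R <= (m%:R : R) `^ (3 / 2) -> (#|V| <= 4 ^ Y.+1 * M)%N.
  move=> cV; rewrite -(ler_nat R) natrM; apply: le_trans cV _.
  have -> : 3 / 2 = 1 + 2^-1 :> R by lra.
  rewrite powRD; last by apply/implyP => _; rewrite pnatr_eq0 -lt0n.
  rewrite powRr1 ?ler0n // powR12_sqrt ?ler0n // -/r.
  apply: ler_pM; rewrite ?ler0n ?ler_nat //; [exact: ltnW | exact: ltW].
have [_ [V1 [V2 [cV1 cV2 RV]]]] := props _ (alpha 3%N Y3).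
have {}RV := le_trans RV (powM 36).
rewrite ler_nat geq_max in RV; have /andP[R1 R2] := RV.
have bound : (ramsey G1 G2 <= 2 ^ (222 * M))%N.
  apply: (@ramsey_le_exp G1 G2 M Y) => //.
  - exact: leq_trans Y4 mMM.
  - by rewrite order1 (leq_trans (leq_maxl _ _) order).
  - by rewrite order2 (leq_trans (leq_maxr _ _) order).
  - move=> y yY; have [[UU _] _] := props _ (alpha y yY).
    by apply: UG UU; case/andP: yY.
  - move=> y yY; have [[_ UU] _] := props _ (alpha y yY).
    by apply: UG UU; case/andP: yY.
  - by exists V1 => //; apply: VG.
  - by exists V2 => //; apply: VG.
move: bound; rewrite -(ler_nat R) => /le_trans; apply.
rewrite -powR2_nat ler_powR ?ler1n // natrM.
by rewrite -[250]/(250%:R) -[222]/(222%:R); lra.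
Qed.
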